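(* Let $\boldsymbol{p}=(\boldsymbol{p}_1,\dots,\boldsymbol{p}_K)^T$ and $\boldsymbol{q}=(\boldsymbol{q}_1,\dots,\boldsymbol{q}_L)^T$ be vectors of compact real intervals, let $A^{(1)},\dots,A^{(K)}\in\mathbb{R}^{m\times n}$ and $b^{(1)},\dots,b^{(K)},d^{(1)},\dots,d^{(L)}\in\mathbb{R}^m$, and consider the linear interval parametric system $A(p)x=b(p,q)$, $p\in\boldsymbol{p}$, $q\in\boldsymbol{q}$. If $\Sigma^{tol}\neq\emptyset$, then $\Sigma^{tol}_{unb}=\Sigma^{tol}_{ker}$.
   Context: An interval is a set $[\underline{c},\overline{c}]\subset\mathbb{R}$ with real endpoints $\underline{c}\le\overline{c}$ (degenerate intervals are allowed). $p\in\boldsymbol{p}$ means $p\in\mathbb{R}^K$ with $p_k\in\boldsymbol{p}_k$ for all $k$, and similarly for $q\in\boldsymbol{q}$. Here $A(p)=\sum_{k=1}^K p_kA^{(k)}$ and $b(p,q)=\sum_{k=1}^K p_kb^{(k)}+\sum_{\ell=1}^L q_\ell d^{(\ell)}$. The tolerable solution set is $\Sigma^{tol}=\{x\in\mathbb{R}^n : \forall p\in\boldsymbol{p}\ \exists q\in\boldsymbol{q}:\ A(p)x=b(p,q)\}$. The set of its unbounded directions is $\Sigma^{tol}_{unb}=\{y\in\mathbb{R}^n : \exists x\in\Sigma^{tol}\ \forall\alpha\ge 0:\ x+\alpha y\in\Sigma^{tol}\}$. The kernel of the tolerable solution set is $\Sigma^{tol}_{ker}=\{y\in\mathbb{R}^n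 : \forall p\in\boldsymbol{p}:\ A(p)y=0\}$. *)

(* Defs.v *)
From HB Require Import structures.
From mathcomp Require Import all_boot all_order all_algebra.
From mathcomp Require Import boolp classical_sets reals.

Set Implicit Arguments.
Unset Strict Implicit.
Unset Printing Implicit Defensive.

Import Order.TTheory GRing.Theory Num.Theory.
Local Open Scope classical_set_scope.
Local Open Scope ring_scope.

(* An interval vector is given by the vectors [lo] and [hi] of its lower and
   upper endpoints; lo k <= hi k is not built in. *)
Definition ivec (R : realType) (K : nat) (lo hi : 'cV[R]_K) : set 'cV[R]_K :=
  [set p | forall k : 'I_K, lo k 0 <= p k 0 <= hi k 0].

Definition param_mx (R : realType) (m n K : nat)
    (A : 'I_K -> 'M[R]_(m, n)) (p : 'cV[R]_K) : 'M[R]_(m, n) :=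
  \sum_(k < K) p k 0 *: A k.

Definition param_rhs (R : realType) (m K L : nat)
    (b : 'I_K -> 'cV[R]_m) (d : 'I_L -> 'cV[R]_m)
    (p : 'cV[R]_K) (q : 'cV[R]_L) : 'cV[R]_m :=
  \sum_(k < K) p k 0 *: b k + \sum_(l < L) q l 0 *: d l.

Definition tol_set (R : realType) (m n K L : nat)
    (A : 'I_K -> 'M[R]_(m, n)) (b : 'I_K -> 'cV[R]_m) (d : 'I_L -> 'cV[R]_m)
    (p_lo p_hi : 'cV[R]_K) (q_lo q_hi : 'cV[R]_L) : set 'cV[R]_n :=
  [set x | forall p, ivec p_lo p_hi p ->
     exists2 q, ivec q_lo q_hi q & param_mx A p *m x = param_rhs b d p q].

Definition tol_unb (R : realType) (m n K L : nat)
    (A : 'I_K -> 'M[R]_(m, n)) (b : 'I_K -> 'cV[R]_m) (d : 'I_L -> 'cV[R]_m)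
    (p_lo p_hi : 'cV[R]_K) (q_lo q_hi : 'cV[R]_L) : set 'cV[R]_n :=
  [set y | exists2 x, tol_set A b d p_lo p_hi q_lo q_hi x &
     forall alpha : R, 0 <= alpha ->
       tol_set A b d p_lo p_hi q_lo q_hi (x + alpha *: y)].

Definition tol_ker (R : realType) (m n K : nat)
    (A : 'I_K -> 'M[R]_(m, n)) (p_lo p_hi : 'cV[R]_K) : set 'cV[R]_n :=
  [set y | forall p, ivec p_lo p_hi p -> param_mx A p *m y = 0].

(* Main.v *)
(** The right-hand side [b(p,q)] only varies in a bounded set as [q] ranges over
    its box, so for fixed [p] the entries of [alpha A(p) y], which are
    differences of two such right-hand sides, stay bounded for all
    [alpha >= 0]; hence [A(p) y = 0].  Conversely, adding a kernel direction
    leaves [A(p) x] unchanged. *)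
Require Import Defs.
From HB Require Import structures.
From mathcomp Require Import all_boot all_order all_algebra.
From mathcomp Require Import boolp classical_sets reals.

Set Implicit Arguments.
Unset Strict Implicit.
Unset Printing Implicit Defensive.

Import Order.TTheory GRing.Theory Num.Theory.
Local Open Scope classical_set_scope.
Local Open Scope ring_scope.

(** If [c] were nonzero, [alpha = (C + 1) / |c|] would give [|alpha * c| = C + 1 > C]; taking
    [alpha = 0] shows [0 <= C], so this [alpha] is admissible. *)
Lemma ray_bounded_eq0 (R : realFieldType) (c C : R) :
  (forall alpha, 0 <= alpha -> `|alpha * c| <= C) -> c = 0.
Proof.
move=> bound; apply/eqP; apply: contraT => c_neq0.
have c_gt0 : 0 < `|c| by rewrite normr_gt0.
have C_ge0 : 0 <= C by have := bound 0 (lexx 0); rewrite mul0r normr0.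
have t_ge0 : 0 <= (C + 1) / `|c| by rewrite divr_ge0 ?addr_ge0 ?ler01.
have := bound _ t_ge0.
rewrite normrM (ger0_norm t_ge0) divfK ?gt_eqF //.
by rewrite gerDl ler10.
Qed.

(** Two points of a box differ in coordinate [l] by at most its width. The bound does not involve
    [q] and [q'], hence is uniform along a ray. *)
Lemma ivec_lincomb_dist (R : realType) (m L : nat) (d : 'I_L -> 'cV[R]_m)
    (lo hi q q' : 'cV[R]_L) (i : 'I_m) :
  ivec lo hi q -> ivec lo hi q' ->
  `|(\sum_l q l 0 *: d l - \sum_l q' l 0 *: d l) i 0|
    <= \sum_l (hi l 0 - lo l 0) * `|d l i 0|.
Proof.
move=> q_in q'_in; rewrite -sumrB summxE.
apply: le_trans (ler_norm_sum _ _ _) _; apply: ler_sum => l _.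
rewrite -scalerBl mxE normrM ler_wpM2r ?normr_ge0 //.
have /andP[lo_q q_hi] := q_in l; have /andP[lo_q' q'_hi] := q'_in l.
by rewrite ler_norml opprB !lerB.
Qed.

Theorem theorem7 (R : realType) (m n K L : nat)
    (A : 'I_K -> 'M[R]_(m, n)) (b : 'I_K -> 'cV[R]_m) (d : 'I_L -> 'cV[R]_m)
    (p_lo p_hi : 'cV[R]_K) (q_lo q_hi : 'cV[R]_L)
    (hp : forall k : 'I_K, p_lo k 0 <= p_hi k 0)
    (hq : forall l : 'I_L, q_lo l 0 <= q_hi l 0) :
  tol_set A b d p_lo p_hi q_lo q_hi !=set0 ->
  tol_unb A b d p_lo p_hi q_lo q_hi = tol_ker A p_lo p_hi.
Proof.
move=> [x0 x0_tol]; apply/seteqP; split=> y /=.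
  move=> [x x_tol ray_tol] p p_in; apply/matrixP => i j; rewrite ord1 [RHS]mxE.
  have [q q_in eq_q] := x_tol p p_in.
  apply: (@ray_bounded_eq0 _ _ (\sum_l (q_hi l 0 - q_lo l 0) * `|d l i 0|)).
  move=> alpha alpha_ge0.
  have [q' q'_in eq_q'] := ray_tol alpha alpha_ge0 p p_in.
  (* Both systems share the same [p], so subtracting them cancels the [b] terms on the right and
     [A(p) x] on the left. *)
  suff -> : alpha * (param_mx A p *m y) i 0 =
      (\sum_l q' l 0 *: d l - \sum_l q l 0 *: d l) i 0.
    exact: ivec_lincomb_dist.
  have -> : \sum_l q' l 0 *: d l - \sum_l q l 0 *: d l =
      param_rhs b d p q' - param_rhs b d p q.
    by rewrite /param_rhs opprD addrACA subrr add0r.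
  by rewrite -eq_q' -eq_q mulmxDr addrC addKr -scalemxAr [RHS]mxE.
(* Nonemptiness supplies the base point of the ray; the [q] found for [x0] and [p] serves for every
   [alpha]. *)
move=> y_ker; exists x0 => // alpha _ p p_in.
have [q q_in eq_q] := x0_tol p p_in; exists q => //.
by rewrite mulmxDr -scalemxAr y_ker // scaler0 addr0.
Qed.
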